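(* If $N$ is a homogeneous norm on $\mathbb{H}^n$ such that the norm $\|\cdot\|$ on $\mathbb{R}^{2n}$ defined by $\|z\|:=N((z,0))$ is not strictly convex, then $(\mathbb{H}^n,d_N)$ does not have the geodesic linearity property.
   Context: For $n\geq 1$, the Heisenberg group $\mathbb{H}^n$ is the set $\mathbb{R}^{2n}\times\mathbb{R}$ with group law $(z,t)\ast(z',t')=(z+z',\,t+t'+2\omega_n(z,z'))$, where $\omega_n(z,z')=\langle z,J_nz'\rangle$, $J_n=\begin{pmatrix}0&-E_n\\ E_n&0\end{pmatrix}$ and $E_n$ is the $n\times n$ identity matrix. The neutral element is $e=(0,0)$ and $(z,t)^{-1}=(-z,-t)$. For $\lambda>0$ the dilation is $\delta_\lambda(z,t)=(\lambda z,\lambda^2t)$. A homogeneous norm on $\mathbb{H}^n$ is a function $N:\mathbb{H}^n\to[0,\infty)$ with $N(p)=0\Leftrightarrow p=e$, $N(p^{-1})=N(p)$, $N(p\ast q)\leq N(p)+N(q)$ and $N(\delta_\lambda(p))=\lambda N(p)$ for all $p,q\in\mathbb{H}^n$, $\lambda>0$. It induces the left-invariant metric $d_N(p,q)=N(p^{-1}\ast q)$. The function $z\mapsto N((z,0))$ is always a norm on $\mathbb{R}^{2n}$. A norm $\|\cdot\|$ on a real vector space $V$ is strictly convex if for $v,w\in V\setminus\{0\}$, $\|v+w\|=\|v\|+\|w\|$ implies $v=\lambda w$ for some $\lambda>0$. $(\mathbb{H}^n,d_N)$ has the geodesic linearity property if for every map $\gamma:\mathbb{R}\to\mathbb{H}^n$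 with $d_N(\gamma(s_1),\gamma(s_2))=|s_1-s_2|$ for all $s_1,s_2\in\mathbb{R}$ there exists $z_0\in\mathbb{R}^{2n}\setminus\{0\}$ such that $\gamma(s)=\gamma(0)\ast(sz_0,0)$ for all $s\in\mathbb{R}$. *)

(* Defs.v *)
From mathcomp Require Import all_boot all_order all_algebra.
From mathcomp Require Import reals.
Set Implicit Arguments.
Unset Strict Implicit.
Unset Printing Implicit Defensive.
Import Order.TTheory GRing.Theory Num.Theory.
Local Open Scope ring_scope.

Definition heis (R : realType) (n : nat) : Type := ('cV[R]_(n + n) * R)%type.

Definition inner (R : realType) (m : nat) (u v : 'cV[R]_m) : R :=
  \sum_(i < m) u i 0 * v i 0.

Definition heisJ (R : realType) (n : nat) : 'M[R]_(n + n) :=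
  block_mx 0 (- 1%:M) 1%:M 0.

Definition omega (R : realType) (n : nat) (z z' : 'cV[R]_(n + n)) : R :=
  inner z (heisJ R n *m z').

Definition heis_e (R : realType) (n : nat) : heis R n := (0, 0).

Definition heis_mul (R : realType) (n : nat) (p q : heis R n) : heis R n :=
  (p.1 + q.1, p.2 + q.2 + 2 * omega p.1 q.1).

Definition heis_inv (R : realType) (n : nat) (p : heis R n) : heis R n :=
  (- p.1, - p.2).

Definition heis_dil (R : realType) (n : nat) (lambda : R) (p : heis R n) :
  heis R n := (lambda *: p.1, lambda ^+ 2 * p.2).

Record homogeneous_norm (R : realType) (n : nat) (N : heis R n -> R) : Prop := {
  hnorm_ge0 : forall p, 0 <= N p;
  hnorm_eq0 : forall p, N p = 0 <-> p = heis_e R n;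
  hnorm_inv : forall p, N (heis_inv p) = N p;
  hnorm_mul : forall p q, N (heis_mul p q) <= N p + N q;
  hnorm_dil : forall (lambda : R) p, 0 < lambda ->
    N (heis_dil lambda p) = lambda * N p
}.

Definition heis_dist (R : realType) (n : nat) (N : heis R n -> R)
  (p q : heis R n) : R := N (heis_mul (heis_inv p) q).

Definition strictly_convex (R : realType) (V : lmodType R) (nrm : V -> R) : Prop :=
  forall v w : V, v <> 0 -> w <> 0 -> nrm (v + w) = nrm v + nrm w ->
  exists lambda : R, 0 < lambda /\ v = lambda *: w.

Definition geodesic_linearity (R : realType) (n : nat) (N : heis R n -> R) :
  Prop :=
  forall gamma : R -> heis R n,
    (forall s1 s2 : R, heis_dist N (gamma s1) (gamma s2) = `|s1 - s2|) ->
    exists z0 : 'cV[R]_(n + n), z0 <> 0 /\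
      forall s : R, gamma s = heis_mul (gamma 0) (s *: z0, 0).

(* Main.v *)
Require Import Defs.
From mathcomp Require Import all_boot all_order all_algebra.
From mathcomp Require Import reals.
From mathcomp Require Import ring lra.
Import Order.TTheory GRing.Theory Num.Theory.
Local Open Scope ring_scope.

(** Write [||z|| = N (z, 0)].  If [||v + w|| = ||v|| + ||w||] for nonzero [v]
    and [w], then the norm is additive on the whole cone that they span
    ([hnorm_horizontal_cone]).  After normalizing [v] and [w], consider the
    broken line that follows [s |-> (s v, 0)] for [s <= 0] and
    [s |-> (s w, 0)] for [s >= 0].  Each half is isometric because [omega] is
    alternating.  For [a, b >= 0], the distance between the points of parameters
    [- a] and [b] is [N ((a v, 0) * (b w, 0))]: it is at most [a + b] by the
    triangle inequality, and at least [||a v + b w|| = a + b], because dropping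
    the vertical coordinate does not increase a homogeneous norm
    ([hnorm_horizontal_le]).  So the broken line is an isometric embedding of
    the real line, and geodesic linearity would force [v = w]
    after normalization, which is what strict convexity asks of [v] and [w]. *)

Lemma omegaZ (R : realType) (n : nat) (a b : R) (z w : 'cV[R]_(n + n)) :
  omega (a *: z) (b *: w) = a * b * omega z w.
Proof.
rewrite /omega /inner -scalemxAr mulr_sumr; apply: eq_bigr => i _.
by rewrite !mxE; ring.
Qed.

Lemma omegaC (R : realType) (n : nat) (z w : 'cV[R]_(n + n)) :
  omega z w = - omega w z.
Proof.
rewrite /omega /inner /heisJ -[z]vsubmxK -[w]vsubmxK !mul_block_col.
rewrite !mul0mx !add0r !addr0 !mulNmx !mul1mx !big_split_ord /= addrC opprD.
rewrite -!sumrN; congr (_ + _); apply: eq_bigr => i _;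
  by rewrite !col_mxEu !col_mxEd !mxE; ring.
Qed.

Lemma omegazz (R : realType) (n : nat) (z : 'cV[R]_(n + n)) : omega z z = 0.
Proof. by have := omegaC _ _ z z; lra. Qed.

Section HomogeneousNorm.

Variables (R : realType) (n : nat) (N : heis R n -> R).
Hypothesis hN : homogeneous_norm N.
Implicit Types (z v w : 'cV[R]_(n + n)) (p : heis R n).

Lemma heis_mul_scale (a b : R) z (s t : R) :
  heis_mul (a *: z, s) (b *: z, t) = ((a + b) *: z, s + t).
Proof. by rewrite /heis_mul /= omegaZ omegazz !mulr0 addr0 scalerDl. Qed.

(** The multiple [(k z, k t)] is the [k]-th power of [(z, t)] in the group. *)
Lemma hnorm_power_le (k : nat) z (t : R) :
  N (k%:R *: z, k%:R * t) <= k%:R * N (z, t).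
Proof.
elim: k => [|k IHk].
  by rewrite !mul0r scale0r (hnorm_eq0 hN (0, 0)).2.
have := hnorm_mul hN (k%:R *: z, k%:R * t) (z, t).
rewrite -{2}[z]scale1r heis_mul_scale -natr1 !mulrDl !mul1r => /le_trans.
by apply; rewrite lerD2r.
Qed.

(** The [k^2]-th power of [(z, t)] has norm at most [k^2 N (z, t)], while the
    vertical element needed to bring it back to height [0] is a dilation by [k]
    and only costs a multiple of [k]; the bound follows as [k] grows. *)
Lemma hnorm_horizontal_le z (t : R) : N (z, 0) <= N (z, t).
Proof.
have key (k : nat) : (0 < k)%N -> k%:R * (N (z, 0) - N (z, t)) <= N (0, - t).
  move=> k_gt0; have kR_gt0 : 0 < k%:R :> R by rewrite ltr0n.
  have dilz : N (k%:R ^+ 2 *: z, 0) = k%:R ^+ 2 * N (z, 0).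
    rewrite -(hnorm_dil hN) ?exprn_gt0 //.
    by rewrite /heis_dil /= mulr0.
  have dilt : N (0, - (k%:R ^+ 2 * t)) = k%:R * N (0, - t).
    by rewrite -(hnorm_dil hN) // /heis_dil /= scaler0 mulrN.
  have := hnorm_mul hN (k%:R ^+ 2 *: z, k%:R ^+ 2 * t) (0, - (k%:R ^+ 2 * t)).
  rewrite -[X in (X, - _)](scale0r z) heis_mul_scale addr0 subrr scale0r.
  rewrite dilz dilt.
  have := hnorm_power_le (k ^ 2)%N z t; rewrite natrX => pow_le tri_le.
  rewrite -(ler_pM2l kR_gt0); lra.
rewrite leNgt -subr_gt0; apply/negP => gap_gt0.
set c := N (0, - t) in key; set d := N (z, 0) - N (z, t) in key gap_gt0.
have c_ge0 : 0 <= c by exact: hnorm_ge0 hN _.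
have := archi_boundP (divr_ge0 c_ge0 (ltW gap_gt0)).
set k := Num.bound _ => lt_k; have k_gt0 : (0 < k)%N.
  by rewrite -(ltr0n R); apply: le_lt_trans lt_k; rewrite divr_ge0 // ltW.
by move: lt_k; rewrite ltr_pdivrMr // ltNge key.
Qed.

Lemma hnorm_horizontalD z w : N (z + w, 0) <= N (z, 0) + N (w, 0).
Proof. exact: le_trans (hnorm_horizontal_le _ _) (hnorm_mul hN (z, 0) (w, 0)). Qed.

Lemma hnorm_horizontalZ (a : R) z : N (a *: z, 0) = `|a| * N (z, 0).
Proof.
have dil (b : R) : 0 < b -> N (b *: z, 0) = b * N (z, 0).
  by move=> b_gt0; rewrite -(hnorm_dil hN) // /heis_dil /= mulr0.
case: (ltrgtP a 0) => [a_lt0|a_gt0|->].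
- rewrite ltr0_norm // -dil ?oppr_gt0 // -(hnorm_inv hN).
  by rewrite /heis_inv /= oppr0 scaleNr.
- by rewrite gtr0_norm ?dil.
- by rewrite scale0r normr0 mul0r (hnorm_eq0 hN (0, 0)).2.
Qed.

Lemma hnorm_horizontal_gt0 z : z <> 0 -> 0 < N (z, 0).
Proof.
move=> z_neq0; rewrite lt_neqAle (hnorm_ge0 hN) andbT eq_sym.
by apply/eqP => /(hnorm_eq0 hN) [].
Qed.

(** For [b <= a], adding [(a - b) w] to [a v + b w] gives [a (v + w)], of norm
    [a ||v|| + a ||w||]; as the added vector accounts for only [(a - b) ||w||],
    the norm of [a v + b w] cannot fall below [a ||v|| + b ||w||]. *)
Lemma hnorm_horizontal_cone v w (a b : R) :
    N (v + w, 0) = N (v, 0) + N (w, 0) -> 0 <= a -> 0 <= b ->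
  N (a *: v + b *: w, 0) = a * N (v, 0) + b * N (w, 0).
Proof.
wlog le_ba : v w a b / b <= a => [wlog_ba|] addvw a_ge0 b_ge0.
  have [/wlog_ba|/ltW/wlog_ba swap] := leP b a; first exact.
  by rewrite addrC swap 1?addrC // addvw addrC.
apply/eqP; rewrite eq_le; apply/andP; split.
  apply: le_trans (hnorm_horizontalD _ _) _.
  by rewrite !hnorm_horizontalZ !ger0_norm.
have := hnorm_horizontalD (a *: v + b *: w) ((a - b) *: w).
rewrite -addrA -scalerDl [b + _]addrC subrK -scalerDr !hnorm_horizontalZ addvw.
by rewrite !ger0_norm ?subr_ge0 //; lra.
Qed.

Definition broken_line v w (s : R) : heis R n :=
  (s *: (if s <= 0 then v else w), 0).

Lemma heis_distC p q : heis_dist N p q = heis_dist N q p.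
Proof.
rewrite /heis_dist -(hnorm_inv hN) /heis_inv /heis_mul /=.
congr (N (_, _)); first by rewrite opprD opprK addrC.
have omegaN (z w : 'cV[R]_(n + n)) : omega (- z) w = - omega z w.
  by rewrite -[- z]scaleN1r -{1}[w]scale1r omegaZ; ring.
by rewrite !omegaN [omega q.1 p.1]omegaC; ring.
Qed.

(** Across the corner, the group product of the two horizontal segments has a
    vertical coordinate, which may be nonzero: the triangle inequality bounds its
    norm from above whatever that coordinate is, and the projection to height [0]
    bounds it from below by a norm in the cone. *)
Lemma broken_line_isometric v w :
    N (v, 0) = 1 -> N (w, 0) = 1 ->
    (forall a b : R, 0 <= a -> 0 <= b -> N (a *: v + b *: w, 0) = a + b) ->
  forall s1 s2 : R,
    heis_dist N (broken_line v w s1) (broken_line v w s2) = `|s1 - s2|.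
Proof.
move=> Nv Nw cone s1 s2.
wlog le_s12 : s1 s2 / s1 <= s2.
  move=> wlog_s; have [/wlog_s|/ltW/wlog_s swap] := leP s1 s2; first exact.
  by rewrite heis_distC distrC.
rewrite /heis_dist /broken_line /heis_inv /= oppr0 -scaleNr.
have same_side z : N (z, 0) = 1 ->
    N (heis_mul (- s1 *: z, 0) (s2 *: z, 0)) = `|s1 - s2|.
  move=> Nz; rewrite heis_mul_scale addr0 hnorm_horizontalZ Nz mulr1.
  by rewrite distrC addrC.
have [s1_le0|s1_gt0] := leP s1 0; have [s2_le0|s2_gt0] := leP s2 0.
- exact: same_side.
- rewrite ler0_norm ?subr_le0 //; apply/eqP; rewrite eq_le; apply/andP; split.
    apply: le_trans (hnorm_mul hN _ _) _.
    by rewrite !hnorm_horizontalZ Nv Nw normrN ler0_norm // gtr0_norm //; lra.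
  apply: le_trans (hnorm_horizontal_le _ _).
  by rewrite cone ?oppr_ge0 ?(ltW s2_gt0) //; lra.
- by lra.
- exact: same_side.
Qed.

End HomogeneousNorm.

Theorem proposition3p19 (R : realType) (n : nat) (hn : (1 <= n)%N)
    (N : heis R n -> R) (hN : homogeneous_norm N)
    (hsc : ~ strictly_convex (fun z : 'cV[R]_(n + n) => N (z, 0))) :
  ~ geodesic_linearity N.
Proof.
move=> linear; apply: hsc => v w v_neq0 w_neq0 addvw.
have Nv_gt0 := hnorm_horizontal_gt0 _ _ _ hN _ v_neq0.
have Nw_gt0 := hnorm_horizontal_gt0 _ _ _ hN _ w_neq0.
set a := N (v, 0) in addvw Nv_gt0; set b := N (w, 0) in addvw Nw_gt0.
have unit_v : N (a^-1 *: v, 0) = 1.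
  by rewrite hnorm_horizontalZ // gtr0_norm ?invr_gt0 // mulVf ?gt_eqF.
have unit_w : N (b^-1 *: w, 0) = 1.
  by rewrite hnorm_horizontalZ // gtr0_norm ?invr_gt0 // mulVf ?gt_eqF.
have cone (x y : R) : 0 <= x -> 0 <= y ->
    N (x *: (a^-1 *: v) + y *: (b^-1 *: w), 0) = x + y.
  move=> x_ge0 y_ge0; rewrite !scalerA hnorm_horizontal_cone //.
  - by rewrite -/a -/b !mulfVK ?gt_eqF.
  - by rewrite divr_ge0 // ltW.
  - by rewrite divr_ge0 // ltW.
have [z0 [_ lin]] :=
  linear _ (broken_line_isometric _ _ _ hN _ _ unit_v unit_w cone).
(* Linearity at the parameters 1 and -1 identifies both unit directions with
   z0. *)
have eq_w : b^-1 *: w = z0.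
  have := congr1 fst (lin 1).
  by rewrite /broken_line /heis_mul /= ler10 !scale1r scale0r add0r.
have eq_v : a^-1 *: v = z0.
  have := congr1 fst (lin (- 1)).
  rewrite /broken_line /heis_mul /= lerN10 scale0r add0r !scaleN1r.
  exact: oppr_inj.
exists (a / b); split; first by rewrite divr_gt0.
by rewrite -scalerA eq_w -eq_v scalerA divff ?gt_eqF // scale1r.
Qed.
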